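(* Let $\mathbb{F}$ be a finite field of order $q$, let $X_1$ and $X_2$ be disjoint finite sets with $|X_1\cup X_2|=k$, let $M$ be an $\mathbb{F}$-representable $\mathrm{iso}(X_1,X_1\cup X_2)$-fragile matroid, and let $c$ and $d$ be distinct elements not in $E(M)$. Then there exists an $\mathrm{iso}(\{c\},\{c,d\})$-fragile matroid $M'$, representable over the field of order $q^{k^2}$, such that $E(M')=(E(M)-(X_1\cup X_2))\cup\{c,d\}$ and $M'/ c\setminus d=M/ X_1\setminus X_2$.
   Context: A matroid $M$ is $N$-fragile if $N$ is a minor of $M$ (meaning $N$ itself, on the ground set $E(N)\subseteq E(M)$, equals $M/C\setminus D$ for some partition $(C,D)$ of $E(M)-E(N)$; an isomorphic copy does not suffice), but there is no element $e\in E(M)$ such that $N$ is a minor of both $M\setminus e$ and $M/e$. For a finite set $E$ and $B\subseteq E$, $\mathrm{iso}(B,E)$ denotes the matroid on ground set $E$ in which every element of $B$ is a coloop and every element of $E-B$ is a loop. *)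

(* Defs.v *)
From HB Require Import structures.
From mathcomp Require Import all_boot all_order all_algebra.

Set Implicit Arguments.
Unset Strict Implicit.
Unset Printing Implicit Defensive.

(* The finType T is only an ambient universe of labels: a matroid over T has its
   own ground set, which may be any subset of T. *)
Definition matroid_axiom (T : finType) (E : {set T}) (I : {set {set T}}) : bool :=
  [&& [forall A in I, A \subset E],
      set0 \in I,
      [forall A in I, forall B : {set T}, (B \subset A) ==> (B \in I)] &
      [forall A in I, forall B in I,
         (#|A| < #|B|) ==> [exists x in B :\: A, (x |: A) \in I]]].

(* The axioms are boolean, so Leibniz equality of matroids is equality of the
   ground sets and of the families of independent sets (matroid_eq below). *)
Record matroid (T : finType) := Matroid {
  ground : {set T};
  indep : {set {set T}};
  matroidP : matroid_axiom ground indep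
}.

Section Matroids.
Variable T : finType.
Implicit Types (M N : matroid T) (A B C D E : {set T}).

Lemma matroid_eq M N : ground M = ground N -> indep M = indep N -> M = N.
Proof.
case: M N => [E I hM] [E' I' hN] /= eE eI; move: hN; rewrite -eE -eI => hN.
by rewrite (bool_irrelevance hM hN).
Qed.

Lemma matroid_axiomP E (I : {set {set T}}) :
  [/\ forall A, A \in I -> A \subset E,
      set0 \in I,
      forall A B, A \in I -> B \subset A -> B \in I &
      forall A B, A \in I -> B \in I -> #|A| < #|B| ->
        exists2 x, x \in B :\: A & (x |: A) \in I] <-> matroid_axiom E I.
Proof.
split=> [[h1 h2 h3 h4]|/and4P[/forall_inP h1 h2 /forall_inP h3 /forall_inP h4]].
  apply/and4P; split=> //; apply/forall_inP=> // A AI.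
    by apply/forallP=> B; apply/implyP; apply: h3.
  apply/forall_inP=> B BI; apply/implyP=> ltAB.
  by have [x xB xA] := h4 _ _ AI BI ltAB; apply/exists_inP; exists x.
split=> // [A B AI sBA|A B AI BI ltAB].
  by have /forallP/(_ B)/implyP/(_ sBA) := h3 _ AI.
by have /forall_inP/(_ _ BI)/implyP/(_ ltAB)/exists_inP := h4 _ AI.
Qed.

Lemma indep_ground M A : A \in indep M -> A \subset ground M.
Proof. by have /matroid_axiomP[h _ _ _] := matroidP M; apply: h. Qed.

Lemma indep0 M : set0 \in indep M.
Proof. by have /matroid_axiomP[_ h _ _] := matroidP M. Qed.

Lemma indepS M A B : A \in indep M -> B \subset A -> B \in indep M.
Proof. by have /matroid_axiomP[_ _ h _] := matroidP M; apply: h. Qed.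

Lemma indep_aug M A B : A \in indep M -> B \in indep M -> #|A| < #|B| ->
  exists2 x, x \in B :\: A & (x |: A) \in indep M.
Proof. by have /matroid_axiomP[_ _ _ h] := matroidP M; apply: h. Qed.

Lemma indep_extend M A B : A \in indep M -> B \in indep M -> #|A| <= #|B| ->
  exists S, [/\ S \in indep M, A \subset S, S \subset A :|: B & #|S| = #|B|].
Proof.
have [n] := ubnP (#|B| - #|A|); elim: n A => // n IHn A ltn AI BI leAB.
have [eAB|neAB] := eqVneq #|A| #|B|.
  by exists A; split=> //; rewrite ?subsetUl.
have ltAB : #|A| < #|B| by rewrite ltn_neqAle neAB.
have [x /setDP[xB xA] xAI] := indep_aug AI BI ltAB.
have cxA : #|x |: A| = #|A|.+1 by rewrite cardsU1 xA.
have lt' : #|B| - #|x |: A| < n.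
  by rewrite cxA; apply: leq_trans (ltn : _ <= n); rewrite subnS prednK ?subn_gt0.
have [|S [SI sS S_ cS]] := IHn _ lt' xAI BI; first by rewrite cxA.
exists S; split=> //; first exact: subset_trans (subsetUr _ _) sS.
by apply: subset_trans S_ _; rewrite -setUA subUset sub1set inE xB orbT subxx.
Qed.

Definition basis_in M C B := maxset [pred S | (S \in indep M) && (S \subset C)] B.

Definition basis M B := basis_in M (ground M) B.

Definition coloop M e := e \in ground M /\ forall B, basis M B -> e \in B.

Definition loop M e := e \in ground M /\ [set e] \notin indep M.

Lemma basis_inP M C B : reflect
  [/\ B \in indep M, B \subset C &
      forall S, S \in indep M -> S \subset C -> B \subset S -> S = B]
  (basis_in M C B).
Proof.
apply: (iffP maxsetP) => /= [[/andP[BI sBC] h]|[BI sBC h]].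
  by split=> // S SI sSC; apply: h; rewrite SI.
by split=> [|S /andP[SI sSC]]; [rewrite BI | apply: h].
Qed.

Lemma basis_extend M C A : A \in indep M -> A \subset C ->
  exists2 B, basis_in M C B & A \subset B.
Proof.
move=> AI sAC.
have [|B mB sAB] := @maxset_exists _ [pred S | (S \in indep M) && (S \subset C)] A.
  by rewrite /= AI.
by exists B.
Qed.

Lemma basis_swap M C A B B' : [disjoint A & C] ->
  basis_in M C B -> basis_in M C B' -> A :|: B \in indep M -> A :|: B' \in indep M.
Proof.
have leB B1 B2 : basis_in M C B1 -> basis_in M C B2 -> #|B1| <= #|B2|.
  move=> /basis_inP[B1I sB1 _] /basis_inP[B2I sB2 m2]; rewrite leqNgt; apply/negP=> lt.
  have [x /setDP[xB1 xB2] xI] := indep_aug B2I B1I lt; case/negP: xB2.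
  rewrite -(m2 _ xI) ?setU11 ?subsetUr //.
  by rewrite subUset sub1set sB2 (subsetP sB1).
move=> dAC hB hB' ABI.
have cB : #|B| = #|B'| by apply/eqP; rewrite eqn_leq !leB.
have /basis_inP[BI sB mB] := hB; have /basis_inP[BI' sB' mB'] := hB'.
have cAU (S : {set T}) : S \subset C -> #|A :|: S| = (#|A| + #|S|)%N.
  move=> sS; rewrite cardsU disjoint_setI0 ?cards0 ?subn0 //.
  exact: disjointWr sS dAC.
have [|S [SI sB'S sS cS]] := indep_extend BI' ABI.
  by rewrite cAU // cB leq_addl.
have SC : S :&: C = B'.
  by apply: mB'; rewrite ?subsetIr ?subsetI ?sB'S // (indepS SI) ?subsetIl.
have sSA : S \subset A :|: B'.
  apply/subsetP=> x xS; have := subsetP sS _ xS; rewrite !inE.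
  case/or3P=> [->|->|xB]; rewrite ?orbT // -SC inE xS (subsetP sB) ?orbT //.
suff <- : S = A :|: B' by [].
by apply/eqP; rewrite eqEcard sSA cS !cAU // cB /=.
Qed.

Definition delete_indep M D := [set A in indep M | [disjoint A & D]].

Lemma delete_axiom M D : matroid_axiom (ground M :\: D) (delete_indep M D).
Proof.
apply/matroid_axiomP; split=> [A|||].
- by rewrite inE subsetD => /andP[/indep_ground-> ->].
- by rewrite inE indep0 disjoints_subset sub0set.
- move=> A B; rewrite !inE => /andP[AI dA] sBA.
  by rewrite (indepS AI sBA) (disjointWl sBA).
move=> A B; rewrite !inE => /andP[AI dA] /andP[BI dB] ltAB.
have [x xB xI] := indep_aug AI BI ltAB; exists x => //.
rewrite inE xI -setI_eq0 setIUl (disjoint_setI0 dA) setU0 setI_eq0 /=.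
by rewrite disjoints1 (disjointFr dB) //; case/setDP: xB.
Qed.

Definition delete M D : matroid T := Matroid (delete_axiom M D).

Definition contract_indep M C :=
  [set A : {set T} | (A \subset ground M :\: C) &&
                     [exists B, basis_in M C B && (A :|: B \in indep M)]].

Lemma contract_axiom M C : matroid_axiom (ground M :\: C) (contract_indep M C).
Proof.
apply/matroid_axiomP; split=> [A|||].
- by rewrite inE => /andP[].
- rewrite inE sub0set /=; have [B hB _] := basis_extend (indep0 M) (sub0set C).
  by apply/existsP; exists B; rewrite hB set0U; case/basis_inP: hB.
- move=> A B; rewrite !inE => /andP[sA /existsP[S /andP[hS SI]]] sBA.
  rewrite (subset_trans sBA sA); apply/existsP; exists S.
  by rewrite hS (indepS SI) // setSU.
move=> A A'; rewrite !inE => /andP[sA /existsP[B /andP[hB ABI]]].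
move=> /andP[sA' /existsP[B' /andP[hB' A'BI]]] ltA.
have dA : [disjoint A & C] by move: sA; rewrite subsetD => /andP[].
have dA' : [disjoint A' & C] by move: sA'; rewrite subsetD => /andP[].
have {hB' A'BI} A'BI := basis_swap dA' hB' hB A'BI.
have sB : B \subset C by case/basis_inP: hB.
have cU (S : {set T}) : [disjoint S & C] -> #|S :|: B| = (#|S| + #|B|)%N.
  move=> dS; rewrite cardsU disjoint_setI0 ?cards0 ?subn0 //.
  exact: disjointWr sB dS.
have [|x] := indep_aug ABI A'BI; first by rewrite !cU // ltn_add2r.
rewrite !inE negb_or => /andP[/andP[xA xB]]; rewrite (negPf xB) orbF => xA' xI.
exists x; rewrite !inE ?xA //.
rewrite subUset sub1set (subsetP sA') //= sA; apply/existsP; exists B.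
by rewrite hB -setUA.
Qed.

Definition contract M C : matroid T := Matroid (contract_axiom M C).

Definition iso_indep B E := powerset (B :&: E).

Lemma iso_axiom B E : matroid_axiom E (iso_indep B E).
Proof.
apply/matroid_axiomP; split=> [A|||].
- by rewrite inE subsetI => /andP[].
- by rewrite inE sub0set.
- by move=> A S; rewrite !inE => sA /subset_trans; apply.
move=> A S; rewrite !inE => sA sS ltAS.
have /subsetPn[x xS xA] : ~~ (S \subset A).
  by apply/negP=> /subset_leq_card; rewrite leqNgt ltAS.
by exists x; rewrite !inE ?xA // subUset sub1set (subsetP sS).
Qed.

Definition iso B E : matroid T := Matroid (iso_axiom B E).

Lemma isoP M B E : B \subset E ->
  [/\ ground M = E,
      forall e, e \in B -> coloop M e &
      forall e, e \in E :\: B -> loop M e] <-> M = iso B E.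
Proof.
move=> sBE; split=> [[gM cM lM]|->]; last first.
  have bB S : basis (iso B E) S -> S = B.
    move=> /basis_inP[]; rewrite inE (setIidPl sBE) => sS _ h.
    by rewrite (h B) // inE (setIidPl sBE).
  split=> // e; first by move=> eB; split=> [|S /bB->//]; apply: (subsetP sBE).
  by move=> /setDP[eE eB]; split=> //; rewrite inE (setIidPl sBE) sub1set.
have [B0 bB0 _] := basis_extend (indep0 M) (sub0set (ground M)).
have B0I : B0 \in indep M by case/basis_inP: bB0.
have sB : B \subset B0 by apply/subsetP=> e /cM[_]; apply.
apply: matroid_eq => //=; apply/setP=> A; rewrite inE (setIidPl sBE).
apply/idP/idP=> [AI|sA]; last by apply: indepS B0I (subset_trans sA sB).
have sAE := indep_ground AI.
apply/subsetP=> e eA; apply/negPn/negP=> eB.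
have [|_ /negP[]] := lM e; last by apply: indepS AI _; rewrite sub1set.
by rewrite inE eB -gM (subsetP sAE).
Qed.

Definition is_minor N M :=
  ground N \subset ground M /\
  exists C D : {set T},
    [/\ [disjoint C & D],
        C :|: D = ground M :\: ground N &
        N = delete (contract M C) D].

Definition fragile N M :=
  is_minor N M /\
  ~ (exists e : T, [/\ e \in ground M,
                       is_minor N (delete M [set e]) &
                       is_minor N (contract M [set e])]).

(* The v x for x in the ground set are the columns of the representing matrix;
   free is applied to the family (with repetitions) of columns indexed by A. *)
Definition representable (F : fieldType) M :=
  exists (n : nat) (v : T -> 'cV[F]_n),
    forall A, A \subset ground M -> (A \in indep M) = free [seq v x | x in A].

End Matroids.

(* Main.v *)
From HB Require Import structures.
Require Import Defs.
From mathcomp Require Import all_boot all_order all_algebra.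
From mathcomp Require Import all_fingroup all_solvable all_field.

(** Write [X = X1 :|: X2] and [E = E(M)].  For a representation [v] of [M],
    contracting [C] and deleting the rest of [E - X] leaves [iso X1 X] exactly
    when [v C] spans [v X2] and [X1] is independent modulo [v C]; fragility says
    that exactly one [C], contained in [E - X], has this property.  Over an
    extension [K] of degree [k^2], combine the rows of [X1] with coefficients
    [g ^ i x] into a row [c] and the columns of [X2] with coefficients
    [g ^ (k * i y)] into a column [d], where [i] numbers [X] and the first [k^2]
    powers of [g] are independent over [F].  After pivoting on [C], the [(c,d)]
    entry is a combination of the entries of the [X1]-[X2] block with
    coefficients [g ^ (i x + k * i y)], so it vanishes only when the block does:
    [C] yields [iso {c} {c,d}] in the new matroid only if it yields [iso X1 X] in
    [M], and uniqueness is inherited.  The new matroid must be representable over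
    every field of order [q^(k^2)], which holds because finite fields of equal
    order are isomorphic. *)

Set Implicit Arguments.
Unset Strict Implicit.
Unset Printing Implicit Defensive.

Import GRing.Theory.
Local Open Scope ring_scope.

(** * Finite fields *)

Lemma finField_generator (F : finFieldType) :
  exists g : F, forall x, x != 0 -> exists i : nat, x = g ^+ i.
Proof.
have /cyclicP[u Gu] := field_unit_group_cyclic [set: {unit F}]%G.
exists (val u) => x nz; pose y := finField_unit nz.
have /cycleP[i e] : y \in <[u]>%g by rewrite -Gu inE.
by exists i; rewrite -FinRing.val_unitX -e.
Qed.



(** The minimal polynomial of [g] over the subfield [1%AS] has coefficients in the image of [F0],
    and divisibility does not change under this base change. *)
Lemma annihilator_generator (F0 : fieldType) (L : fieldExtType F0) (g : L) :
  exists m : {poly F0}, forall P : {poly F0},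
    (m %| P) = root (map_poly (in_alg L) P) g.
Proof.
have /polyOver1P[m em] := minPolyOver 1%AS g.
exists m => P; rewrite -(dvdp_map (in_alg L)) -em.
apply/idP/idP => [d|r]; first exact: root_dvdp d (root_minPoly _ _).
by apply: minPoly_dvdp => //; apply/polyOver1P; exists P.
Qed.

(** Sending the value of [P] at [g] to its value at [z] is well defined, because a polynomial that
    kills [g] kills [z]. *)
Lemma fieldExt_embedding (F0 : fieldType) (L K : fieldExtType F0) (g : L) (z : K) :
  (forall x : L, exists P : {poly F0}, (map_poly (in_alg L) P).[g] == x) ->
  (forall P : {poly F0}, root (map_poly (in_alg L) P) g ->
                         root (map_poly (in_alg K) P) z) ->
  exists f : {rmorphism L -> K}, True.
Proof.
move=> gen ann; pose eL P := (map_poly (in_alg L) P).[g].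
pose eK P := (map_poly (in_alg K) P).[z].
have eLK P Q : eL P = eL Q -> eK P = eK Q.
  move=> /eqP; rewrite -subr_eq0 => e; apply/eqP; rewrite -subr_eq0.
  have /ann : root (map_poly (in_alg L) (P - Q)) g.
    by rewrite /root rmorphB hornerD hornerN.
  by rewrite /root rmorphB hornerD hornerN.
pose r x := xchoose (gen x); have rP x : eL (r x) = x by apply/eqP/(xchooseP (gen x)).
pose f x := eK (r x).
have fB : zmod_morphism f.
  move=> x y; rewrite /f /eK -hornerN -hornerD -rmorphB.
  by apply: eLK; rewrite rP /eL rmorphB hornerD hornerN -!/(eL _) !rP.
have fM : monoid_morphism f.
  split.
    rewrite /f (eLK _ 1) /eK ?rmorph1 ?hornerC // rP /eL rmorph1 hornerC //.
  move=> x y; rewrite /f /eK -hornerM -rmorphM.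
  by apply: eLK; rewrite rP /eL rmorphM hornerM -!/(eL _) !rP.
pose fA := GRing.isZmodMorphism.Build L K f fB.
pose fR := GRing.isMonoidMorphism.Build L K f fM.
by exists (HB.pack_for {rmorphism L -> K} f fA fR).
Qed.

(** Over the common prime field, the minimal polynomial of a generator of [F] divides [X^#|K| - X],
    which splits in [K]; this gives an image for the generator. *)
Lemma finField_embedding (F K : finFieldType) (n : nat) :
  #|K| = (#|F| ^ n)%N -> exists f : {rmorphism F -> K}, True.
Proof.
move=> cK; have [p pr_p hF] := finPcharP F.
have cF := card_pprimeChar hF; rewrite cF -expnM in cK.
have hK : p \in [pchar K] := card_finPcharP cK pr_p.
pose L := pPrimeCharType hF; pose K' := pPrimeCharType hK.
have [g gP] := finField_generator F.
have [m mP] := annihilator_generator (g : L).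
have xqx (x : F) : x ^+ #|K| = x.
  rewrite cK expnM -cF; elim: (n) => [|j IHj]; first by rewrite expr1.
  by rewrite expnSr exprM IHj expf_card.
have dm : m %| 'X^#|K| - 'X.
  by rewrite mP /root rmorphB rmorphXn /= map_polyX !hornerE [_ ^+ _]xqx subrr.
have [z zm] : exists z : K', root (map_poly (in_alg K') m) z.
  have := dm; rewrite -(dvdp_map (in_alg K')) rmorphB rmorphXn /= map_polyX.
  rewrite (finField_genPoly K) => /dvdp_prod_XsubC[b].
  (* With no linear factor left, [m] would divide 1, which has no root. *)
  case: (mask b _) => [|z s] e; last first.
    by exists z; rewrite (eqp_root e) big_cons rootM root_XsubC eqxx.
  have : m %| 1.
    by rewrite -(dvdp_map (in_alg K')) rmorph1 (eqp_dvdl _ e) big_nil dvdpp.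
  by rewrite mP rmorph1 (negPf (root1 _)).
apply: (@fieldExt_embedding _ L K' g z) => [x|P].
  have [->|/gP[i ->]] := eqVneq x 0; first by exists 0; rewrite rmorph0 horner0.
  by exists 'X^i; rewrite rmorphXn /= map_polyX hornerXn.
rewrite -mP => d; apply: root_dvdp zm; by rewrite dvdp_map.
Qed.

(* Take [g] to be a multiplicative generator of [K]: a linear relation over [F]
   among the first [n] powers of [g] would leave [K] with at most
   [#|F| ^ n.-1] elements. *)
Lemma finField_power_independent (F K : finFieldType) (f : {rmorphism F -> K}) n :
  #|K| = (#|F| ^ n)%N ->
  exists g : K, forall P : {poly F}, (size P <= n)%N ->
    root (map_poly f P) g -> P = 0.
Proof.
move=> cK; have [g gP] := finField_generator K; exists g => P sP rP.
apply/eqP/negPn/negP => nzP.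
have n0 : (0 < n)%N by apply: leq_trans sP; rewrite size_poly_gt0.
pose h (w : 'rV[F]_n.-1) : K := (map_poly f (rVpoly w)).[g].
have sur (x : K) : exists w, h w = x.
  have [Q <-] : exists Q : {poly F}, (map_poly f Q).[g] = x.
    have [->|/gP[i ->]] := eqVneq x 0; first by exists 0; rewrite rmorph0 horner0.
    by exists 'X^i; rewrite rmorphXn /= map_polyX hornerXn.
  (* The remainder modulo [P] has the same value at [g] and, as [size P <= n], at most [n.-1]
     coefficients. *)
  exists (poly_rV (Q %% P)); rewrite /h poly_rV_K; last first.
    by rewrite -ltnS prednK // (leq_trans _ sP) // ltn_modp.
  by rewrite {2}(divp_eq Q P) rmorphD rmorphM hornerD hornerM (rootP rP) mulr0 add0r.
have [s sP'] := fin_all_exists sur; have := leq_card s (can_inj sP').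
by rewrite card_mx mul1n cK leq_exp2l ?finNzRing_gt1 // -[X in (X <= _)%N](prednK n0) ltnn.
Qed.

Lemma finField_extension (F : finFieldType) n : (0 < n)%N ->
  exists2 K : finFieldType, #|K| = (#|F| ^ n)%N & exists f : {rmorphism F -> K}, True.
Proof.
move=> n0; have [p pr_p hF] := finPcharP F; have cF := card_pprimeChar hF.
have l0 : (0 < logn p #|F| * n)%N.
  rewrite muln_gt0 n0 andbT lt0n; apply: contraTneq (finNzRing_gt1 F) => e.
  by rewrite cF e.
have [K _ cK] := pPrimePowerField pr_p l0.
rewrite expnM -cF in cK; exists K => //; exact: finField_embedding cK.
Qed.

(** * Vector matroids and their minors *)

Section FiniteFamilies.
Variables (F : fieldType) (T : finType) (vT : vectType F).
Implicit Types (v : T -> vT) (A B C D E X : {set T}) (M : matroid T).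
Implicit Types (U : {vspace vT}) (w : vT) (t : T -> F).

Definition fspan v A : {vspace vT} := <<[seq v x | x in A]>>%VS.

(** For [U = 0] this is freeness of the indexed family; for the span of a contracted set it is
    independence in the contraction. *)
Definition indep_mod v (U : {vspace vT}) A :=
  forall t : T -> F, \sum_(x in A) t x *: v x \in U -> {in A, forall x, t x = 0}.

Lemma fspanE v A : fspan v A = (\sum_(x in A) <[v x]>)%VS.
Proof. by rewrite /fspan span_def big_image. Qed.

Lemma fspanP v A w :
  reflect (exists t : T -> F, w = \sum_(x in A) t x *: v x) (w \in fspan v A).
Proof.
rewrite fspanE; apply: (iffP memv_sumP) => [[vs vsP ->]|[t ->]].
  have [x|t tP] := @fin_all_exists _ _ (fun x k => x \in A -> vs x = k *: v x).
    by case: (boolP (x \in A)) => [/vsP/vlineP[k e]|_]; [exists k|exists 0].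
  by exists t; apply: eq_bigr => x /tP.
by exists (fun x => t x *: v x) => // x _; rewrite memvZ ?memv_line.
Qed.

Lemma mem_fspan v A x : x \in A -> v x \in fspan v A.
Proof. by move=> xA; apply/memv_span/image_f. Qed.

Lemma fspan_sub v A (U : {vspace vT}) :
  {in A, forall x, v x \in U} -> (fspan v A <= U)%VS.
Proof. by move=> h; rewrite fspanE; apply/subv_sumP => x /h. Qed.

Lemma fspanS v A B : A \subset B -> (fspan v A <= fspan v B)%VS.
Proof. by move=> /subsetP sAB; apply: fspan_sub => x /sAB; apply: mem_fspan. Qed.

Lemma memv_fsum v A (t : T -> F) (U : {vspace vT}) :
  {in A, forall x, v x \in U} -> \sum_(x in A) t x *: v x \in U.
Proof. by move=> h; apply: memv_suml => x /h; apply: memvZ. Qed.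

Lemma sum_disjointU (V : nmodType) A B (f : T -> V) : [disjoint A & B] ->
  \sum_(x in A :|: B) f x = \sum_(x in A) f x + \sum_(x in B) f x.
Proof. by move=> dAB; rewrite -bigU //; apply: eq_bigl => x; rewrite !inE. Qed.

Lemma free_imageP v A : reflect (indep_mod v 0%VS A) (free [seq v x | x in A]).
Proof.
have eX (i : 'I_#|A|) : [tuple of map v (enum_tuple A)]`_i = v (enum_val i).
  rewrite (nth_map (enum_val i)) ?size_tuple //.
  by rewrite /enum_val (set_nth_default (enum_default i)) ?size_tuple.
have sX (k : T -> F) :
    \sum_(x in A) k x *: v x =
      \sum_(i < #|A|) k (enum_val i) *: [tuple of map v (enum_tuple A)]`_i.
  by rewrite big_enum_val /=; apply: eq_bigr => i _; rewrite -eX.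
have -> : [seq v x | x in A] = [tuple of map v (enum_tuple A)] :> seq vT by [].
apply: (iffP (@freeP _ _ _ [tuple of map v (enum_tuple A)])) => [h t|h k k0 i].
  rewrite memv0 sX => /eqP/h t0 x xA.
  by rewrite -[x](enum_rankK_in xA xA) t0.
pose t x := k (enum_rank_in (enum_valP i) x).
have tE j : t (enum_val j) = k j by rewrite /t enum_valK_in.
rewrite -tE; apply: h (enum_valP i); rewrite sX memv0.
by apply/eqP; rewrite -[RHS]k0; apply: eq_bigr => j _; rewrite tE.
Qed.

Lemma fspan_dep v A x : free [seq v y | y in A] -> x \notin A ->
  ~~ free [seq v y | y in x |: A] -> v x \in fspan v A.
Proof.
move=> /free_imageP fA xA; apply: contraR => vx; apply/free_imageP => t.
rewrite big_setU1 //= memv0 => /eqP t0.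
have tx0 : t x = 0.
  apply: contraNeq vx => nz; have /(congr1 (fun w => (t x)^-1 *: w)) := t0.
  rewrite scalerDr scalerA mulVf // scale1r scaler0 => /eqP.
  rewrite addr_eq0 => /eqP ->; rewrite memvN memvZ //.
  by apply/fspanP; exists t.
move=> y /setU1P[->//|yA]; apply: fA yA; rewrite memv0; move: t0.
by rewrite tx0 scale0r add0r => ->.
Qed.

Lemma indep_modS v U A B : B \subset A -> indep_mod v U A -> indep_mod v U B.
Proof.
move=> sBA fA t t0 x xB.
suff /fA/(_ x (subsetP sBA x xB)) :
    \sum_(y in A) (if y \in B then t y else 0) *: v y \in U by rewrite xB.
rewrite (big_setID B) /= (setIidPr sBA) [X in _ + X]big1 ?addr0 => [|y].
  by rewrite (eq_bigr (fun y => t y *: v y)) // => y ->.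
by rewrite inE => /andP[/negPf->]; rewrite scale0r.
Qed.

Lemma indep_mod1 v U x : indep_mod v U [set x] <-> v x \notin U.
Proof.
split=> [h|vx t]; last first.
  rewrite big_set1 => tU y /set1P->; apply: contraNeq vx => nz.
  by rewrite -[v x](scalerK nz) memvZ.
apply/negP => vx; have := h (fun=> 1); rewrite big_set1 scale1r.
by move=> /(_ vx x (set11 x))/eqP; rewrite oner_eq0.
Qed.

Lemma free_image_card v A : free [seq v y | y in A] -> \dim (fspan v A) = #|A|.
Proof. by rewrite /free size_image => /eqP. Qed.

Lemma vector_matroid_axiom v (E : {set T}) :
  matroid_axiom E [set A : {set T} | (A \subset E) && free [seq v x | x in A]].
Proof.
apply/matroid_axiomP; split=> [A||A B|A B].
- by rewrite inE => /andP[].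
- rewrite inE sub0set; apply/free_imageP => t _ x; by rewrite inE.
- rewrite !inE => /andP[sA fA] sBA.
  rewrite (subset_trans sBA sA) /=.
  by apply/free_imageP/(indep_modS sBA)/free_imageP.
rewrite !inE => /andP[sA fA] /andP[sB fB] ltAB.
have [/exists_inP[x xB xf]|/exists_inPn h] :=
  boolP [exists x in B :\: A, free [seq v y | y in x |: A]].
  exists x => //; rewrite inE xf andbT subUset sub1set sA andbT.
  by apply: (subsetP sB); case/setDP: xB.
suff /dimvS : (fspan v B <= fspan v A)%VS by rewrite !free_image_card // leqNgt ltAB.
apply: fspan_sub => x xB; have [/mem_fspan->//|xA] := boolP (x \in A).
by apply: fspan_dep => //; apply: h; rewrite inE xA.
Qed.

Definition vector_matroid v E : matroid T := Matroid (vector_matroid_axiom v E).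

Definition represents v (M : matroid T) :=
  forall A, A \subset ground M -> (A \in indep M) = free [seq v x | x in A].

Lemma vector_matroid_represents v E : represents v (vector_matroid v E).
Proof. by move=> A /= sA; rewrite inE sA. Qed.

Lemma basis_fspan v (M : matroid T) C B : represents v M -> C \subset ground M ->
  basis_in M C B -> fspan v B = fspan v C.
Proof.
move=> rv sC /basis_inP[BI sB mB]; apply/eqP.
rewrite eqEsubv fspanS //=; apply: fspan_sub => x xC.
have [/mem_fspan->//|xB] := boolP (x \in B).
have sB' := subset_trans sB sC.
have sxB : x |: B \subset C by rewrite subUset sub1set xC.
apply: fspan_dep => //; rewrite -rv ?(subset_trans sxB) //.
apply: contra xB => xI; rewrite -(mB _ xI) ?setU11 ?subsetUr //.
Qed.

(** Contraction is defined through a basis of [C], whose columns are free and span the same space as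
    those of [C]. *)
Lemma contract_indepP v (M : matroid T) C A : represents v M -> C \subset ground M ->
  reflect (A \subset ground M :\: C /\ indep_mod v (fspan v C) A)
          (A \in indep (contract M C)).
Proof.
move=> rv sC; rewrite inE; apply: (iffP andP) => -[sA].
  move=> /existsP[B /andP[bB ABI]]; split=> // t.
  have /basis_inP[BI sB _] := bB.
  have /free_imageP fAB : free [seq v x | x in A :|: B].
    by rewrite -rv ?(indep_ground ABI).
  have dAB : [disjoint A & B].
    by apply: disjointWr sB _; move: sA; rewrite subsetD => /andP[].
  rewrite -(basis_fspan rv sC bB) => /fspanP[s es] x xA.
  suff /fAB/(_ x) :
      \sum_(y in A :|: B) (if y \in A then t y else - s y) *: v y \in 0%VS.
    by rewrite inE xA; apply.
  rewrite memv0 sum_disjointU //=; apply/eqP.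
  rewrite (eq_bigr (fun x => t x *: v x)) => [|y ->//].
  rewrite es -[RHS](subrr (\sum_(y in B) s y *: v y)) -sumrN; congr (_ + _).
  by apply: eq_bigr => y yB; rewrite (disjointFl dAB) // scaleNr.
move=> fA; split=> //.
have [B bB _] := basis_extend (indep0 M) (sub0set C).
have /basis_inP[BI sB _] := bB.
have sBE := subset_trans sB sC.
have sAE : A \subset ground M by move: sA; rewrite subsetD => /andP[].
have dAB : [disjoint A & B].
  by apply: disjointWr sB _; move: sA; rewrite subsetD => /andP[].
apply/existsP; exists B; rewrite bB rv ?subUset ?sAE //=.
apply/free_imageP => t; rewrite memv0 sum_disjointU //= addr_eq0 => /eqP e.
have tA : {in A, forall x, t x = 0}.
  apply: fA; rewrite e memvN memv_fsum // => x xB.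
  by apply: mem_fspan; apply: (subsetP sB).
have /free_imageP fB : free [seq v x | x in B] by rewrite -rv.
move=> x /setUP[/tA//|]; apply: fB; rewrite memv0 -oppr_eq0 -e; apply/eqP.
by rewrite big1 // => y /tA ->; rewrite scale0r.
Qed.


Lemma represents_delete v M D : represents v M -> represents v (delete M D).
Proof.
by move=> rv A; rewrite subsetD => /andP[sA dA]; rewrite -rv // inE dA andbT.
Qed.

(** A model of the quotient by [U] inside the space itself: an endomorphism with kernel [U], so a
    contraction is represented by vectors of the same space. *)
Definition qmap (U : {vspace vT}) : 'End(vT) := (\1 - projv U)%VF.

Lemma qmap_eq0 U w : (qmap U w == 0) = (w \in U).
Proof.
rewrite add_lfunE opp_lfunE id_lfunE subr_eq0; apply/eqP/idP => [->|/projv_id//].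
exact: memv_proj.
Qed.

Lemma qmap_sum U v A (t : T -> F) :
  \sum_(x in A) t x *: qmap U (v x) = qmap U (\sum_(x in A) t x *: v x).
Proof. by rewrite linear_sum; apply: eq_bigr => x _; rewrite linearZ. Qed.

Lemma qmap_fspan v C C' w :
  (qmap (fspan v C) w \in fspan (qmap (fspan v C) \o v) C') =
  (w \in fspan v (C :|: C')).
Proof.
set Q := qmap _; apply/idP/idP => [/fspanP[t e]|].
  rewrite -[w](subrK (\sum_(x in C') t x *: v x)) memvD //; last first.
    apply: memv_fsum => x xC; apply: mem_fspan; by rewrite inE xC orbT.
  apply: (subvP (fspanS v (subsetUl C C'))).
  by rewrite -qmap_eq0 linearB /= e qmap_sum subrr.
have : (fspan v (C :|: C') <= Q @^-1: fspan (Q \o v) C')%VS.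
  apply: fspan_sub => x; rewrite -memv_preim => /setUP[xC|xC].
    suff /eqP-> : Q (v x) == 0 by rewrite mem0v.
    by rewrite qmap_eq0 mem_fspan.
  exact: (@mem_fspan (Q \o v)).
by move=> /subvP h /h; rewrite -memv_preim.
Qed.

Lemma represents_contract v M C : represents v M -> C \subset ground M ->
  represents (qmap (fspan v C) \o v) (contract M C).
Proof.
move=> rv sC A sA; apply/(contract_indepP _ rv sC)/free_imageP.
  by move=> -[_ h] t; rewrite qmap_sum memv0 qmap_eq0; apply: h.
move=> h; split=> // t t0; apply: h; by rewrite qmap_sum memv0 qmap_eq0.
Qed.

Definition iso_contraction v (X1 X2 C : {set T}) :=
  indep_mod v (fspan v C) X1 /\ {in X2, forall y, v y \in fspan v C}.

Lemma iso_contraction_qmap v X1 X2 C C' :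
  iso_contraction (qmap (fspan v C) \o v) X1 X2 C' <->
  iso_contraction v X1 X2 (C :|: C').
Proof.
split=> -[h1 h2]; split=> [t|y /h2]; rewrite -?qmap_fspan //.
- by rewrite -qmap_sum; apply: h1.
- by rewrite qmap_sum qmap_fspan; apply: h1.
Qed.

(** The independent sets of the iso matroid are the subsets of [X1], so [X1] has to stay independent
    modulo [fspan v C] while every element of [X2] becomes a loop. *)
Lemma iso_contractionP v M X1 X2 C D : represents v M -> [disjoint X1 & X2] ->
  X1 :|: X2 \subset ground M -> [disjoint C & D] ->
  C :|: D = ground M :\: (X1 :|: X2) ->
  delete (contract M C) D = iso X1 (X1 :|: X2) <-> iso_contraction v X1 X2 C.
Proof.
move=> rv dX sX dCD eCD.
have sC : C \subset ground M.
  by apply: subset_trans (subsetDl _ (X1 :|: X2)); rewrite -eCD subsetUl.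
have eX : ground M :\: C :\: D = X1 :|: X2.
  by rewrite setDDl eCD setDDr setDv set0U (setIidPr sX).
have [sX1 sX2] : X1 \subset X1 :|: X2 /\ X2 \subset X1 :|: X2.
  by rewrite subsetUl subsetUr.
have XP (A : {set T}) :
    (A \subset X1 :|: X2) = (A \subset ground M :\: C) && [disjoint A & D].
  by rewrite -eX subsetD.
split=> [e|[h1 h2]].
  have inI A : A \in delete_indep (contract M C) D = (A \subset X1).
    by move: (congr1 (@indep T) e) => /= ->; rewrite inE (setIidPl sX1).
  split=> [|y yX2].
    have := inI X1; rewrite subxx inE => /andP[/(contract_indepP _ rv sC)[]//].
  have /andP[sy dy] : ([set y] \subset ground M :\: C) && [disjoint [set y] & D].
    by rewrite -XP sub1set (subsetP sX2).
  apply/negPn/negP => /indep_mod1 hy.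
  have := inI [set y]; rewrite inE dy andbT sub1set (disjointFl dX) //.
  by move=> /negP[]; apply/(contract_indepP _ rv sC).
apply: matroid_eq => //=; apply/setP => A; rewrite [LHS]inE [RHS]inE (setIidPl sX1).
apply/andP/idP => [[/(contract_indepP _ rv sC)[sA hA] dA]|sA].
  apply/subsetP => y yA.
  have : y \in X1 :|: X2 by move: y yA; apply/subsetP; rewrite XP sA.
  case/setUP=> // /h2 yC; have /indep_mod1 : indep_mod v (fspan v C) [set y].
    by apply: indep_modS hA; rewrite sub1set.
  by rewrite yC.
have /andP[sA' dA] : (A \subset ground M :\: C) && [disjoint A & D].
  by rewrite -XP (subset_trans sA).
split=> //; apply/(contract_indepP _ rv sC); split=> //.
exact: indep_modS sA h1.
Qed.

Lemma iso_minorP v M X1 X2 : represents v M -> [disjoint X1 & X2] ->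
  is_minor (iso X1 (X1 :|: X2)) M <->
  X1 :|: X2 \subset ground M /\
  exists2 C : {set T}, C \subset ground M :\: (X1 :|: X2) & iso_contraction v X1 X2 C.
Proof.
move=> rv dX; split=> [[sX [C [D [dCD eCD e]]]]|[sX [C sC gC]]]; split=> //.
  exists C; first by move: eCD => /= <-; rewrite subsetUl.
  exact/(iso_contractionP rv dX sX dCD eCD)/esym.
set D := ground M :\: (X1 :|: X2) :\: C.
have dCD : [disjoint C & D] by rewrite disjoint_sym disjoints_subset subsetDr.
have eCD : C :|: D = ground M :\: (X1 :|: X2).
  by rewrite /D setDE setUIr setUCr setIT; apply/setUidPr.
exists C, D; split; [exact: dCD | exact: eCD | apply: esym].
exact/(iso_contractionP rv dX sX dCD eCD).
Qed.

(* Two distinct such sets differ at an element whose deletion and contraction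
   both keep the minor, and conversely. *)
Lemma fragile_isoP v M X1 X2 : represents v M -> [disjoint X1 & X2] ->
  fragile (iso X1 (X1 :|: X2)) M <->
  [/\ X1 :|: X2 \subset ground M,
      exists2 C : {set T}, C \subset ground M :\: (X1 :|: X2) & iso_contraction v X1 X2 C &
      forall C C' : {set T}, C \subset ground M :\: (X1 :|: X2) ->
        C' \subset ground M :\: (X1 :|: X2) ->
        iso_contraction v X1 X2 C -> iso_contraction v X1 X2 C' -> C = C'].
Proof.
move=> rv dX; set X := X1 :|: X2.
split=> [[/(iso_minorP rv dX)[sX exC] frag]|[sX exC uniqC]].
  split=> //.
  suff sub (C C' : {set T}) : C \subset ground M :\: X -> C' \subset ground M :\: X ->
      iso_contraction v X1 X2 C -> iso_contraction v X1 X2 C' -> C \subset C'.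
    by move=> C C' sC sC' gC gC'; apply/eqP; rewrite eqEsubset; apply/andP; split; apply: sub.
  move=> sC sC' gC gC'; apply/subsetP => e eC; apply/negPn/negP => eC'.
  have /setDP[eM eX] := subsetP sC e eC; case: frag; exists e; split=> //.
    apply/(iso_minorP (represents_delete rv) dX); split.
      by rewrite subsetD1 sX.
    by exists C' => //=; rewrite setDDl setUC -setDDl subsetD1 sC'.
  have se : [set e] \subset ground M by rewrite sub1set.
  apply/(iso_minorP (represents_contract rv se) dX); split.
    by rewrite subsetD1 sX.
  exists (C :\ e) => /=.
    by rewrite setDDl setUC -setDDl setSD.
  by apply/iso_contraction_qmap; rewrite setD1K.
split; first by apply/(iso_minorP rv dX).
case=> e [eM /(iso_minorP (represents_delete rv) dX)[/= sXe [C sC gC]]].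
have se : [set e] \subset ground M by rewrite sub1set.
case/(iso_minorP (represents_contract rv se) dX) => _ [C' /= sC'].
move=> /iso_contraction_qmap gC'.
have eX : e \notin X by move: sXe; rewrite subsetD1 => /andP[].
move: sC sC'; rewrite setDDl setUC -setDDl -/X subsetD1 => /andP[sC eC] sC'.
case/negP: eC; rewrite (uniqC C (e |: C')) ?setU11 // subUset sub1set inE eX eM.
by apply: subset_trans sC' (subsetDl _ _).
Qed.

End FiniteFamilies.

(** * Base change of column families *)

Section ColumnFamilies.
Variables (F : fieldType) (T : finType) (n : nat).
Implicit Types (v : T -> 'cV[F]_n) (A : {set T}) (U : {vspace 'cV[F]_n}).

(** Turns freeness into a rank condition, which a field extension preserves. *)
Lemma free_row_free v A :
  free [seq v x | x in A] = row_free (\matrix_(i < #|A|) (v (enum_val i))^T).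
Proof.
set Mx := \matrix_i _.
have mulE (r : 'rV_#|A|) : (r *m Mx)^T = \sum_i r 0 i *: v (enum_val i).
  rewrite mulmx_sum_row linear_sum; apply: eq_bigr => i _.
  by rewrite linearZ /= rowK trmxK.
apply/free_imageP/idP => [h|/row_free_inj inj t].
  rewrite -kermx_eq0; apply/rowV0P => r /sub_kermxP r0; apply/rowP => i.
  rewrite mxE; pose t x := r 0 (enum_rank_in (enum_valP i) x).
  have tE j : t (enum_val j) = r 0 j by rewrite /t enum_valK_in.
  rewrite -tE; apply: h (enum_valP i); rewrite memv0 big_enum_val /=.
  rewrite (eq_bigr (fun j => r 0 j *: v (enum_val j))) => [|j _]; last by rewrite tE.
  by rewrite -mulE r0 trmx0.
rewrite memv0 big_enum_val /= => /eqP t0 x xA.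
have /rowP/(_ (enum_rank_in xA x)) : \row_i t (enum_val i) = 0 :> 'rV_#|A|.
  apply: inj; apply: trmx_inj; rewrite mulE mul0mx trmx0 -[RHS]t0.
  by apply: eq_bigr => i _; rewrite mxE.
by rewrite !mxE enum_rankK_in.
Qed.

Lemma mulmx_of_lfun (Q : 'End('cV[F]_n)) (i : 'I_n) :
  exists h : 'rV[F]_n, forall w, (h *m w) 0 0 = Q w i 0.
Proof.
exists (\row_j Q (delta_mx j 0) i 0) => w; rewrite mxE.
rewrite {2}[w]matrix_sum_delta linear_sum summxE; apply: eq_bigr => j _.
by rewrite big_ord1 linearZ !mxE mulrC.
Qed.

Lemma separating_row U w : w \notin U ->
  exists2 h : 'rV[F]_n, {in U, forall u, (h *m u) 0 0 = 0} & (h *m w) 0 0 != 0.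
Proof.
rewrite -qmap_eq0 => /matrix0Pn[i [j]]; rewrite ord1 => nz.
have [h hE] := mulmx_of_lfun (qmap U) i; exists h; last by rewrite hE.
by move=> u; rewrite hE -qmap_eq0 => /eqP->; rewrite mxE.
Qed.

(** Independence keeps [v x] out of the sum of [U] and the span of the other [v y]; a functional
    separating it from that sum is rescaled to be 1 at [v x]. *)
Lemma dual_rows v U A : indep_mod v U A ->
  exists h : T -> 'rV[F]_n, forall x, x \in A ->
    {in U, forall u, (h x *m u) 0 0 = 0} /\
    {in A, forall y, (h x *m v y) 0 0 = (y == x)%:R}.
Proof.
move=> fA; apply: (fin_all_exists (P := fun x (r : 'rV[F]_n) => x \in A ->
    {in U, forall u, (r *m u) 0 0 = 0} /\
    {in A, forall y, (r *m v y) 0 0 = (y == x)%:R})) => x.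
have [xA|_] := boolP (x \in A); last by exists 0.
have /separating_row[h hW hx] : v x \notin (U + fspan v (A :\ x))%VS.
  apply/memv_addP => -[u uU [w /fspanP[s ->] e]].
  have /fA/(_ x xA) : \sum_(y in A) (if y == x then 1 else - s y) *: v y \in U.
    rewrite (big_setD1 x xA) /= eqxx scale1r.
    rewrite (eq_bigr (fun y => - (s y *: v y))) => [|y].
      by rewrite sumrN e addrK.
    by rewrite !inE => /andP[/negPf-> _]; rewrite scaleNr.
  by rewrite eqxx => /eqP; rewrite oner_eq0.
exists (((h *m v x) 0 0)^-1 *: h) => _; split=> [u uU|y yA].
  have hu : (h *m u) 0 0 = 0 by apply: hW; apply: subvP uU; apply: addvSl.
  by rewrite -scalemxAl mxE hu mulr0.
rewrite -scalemxAl mxE; have [->|nyx] := eqVneq y x; first by rewrite mulVf.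
have hy : (h *m v y) 0 0 = 0.
  apply: hW; apply: (subvP (addvSr U (fspan v (A :\ x)))).
  by rewrite mem_fspan // !inE nyx.
by rewrite hy mulr0.
Qed.

End ColumnFamilies.

Section BaseChange.
Variables (F K : fieldType) (f : {rmorphism F -> K}) (T : finType) (n : nat).
Variable v : T -> 'cV[F]_n.
Implicit Types (A C : {set T}).

Lemma free_map_mx A :
  free [seq map_mx f (v x) | x in A] = free [seq v x | x in A].
Proof.
rewrite !free_row_free -(row_free_map f); congr row_free.
by apply/matrixP => i j; rewrite !mxE.
Qed.

Lemma represents_map M : represents v M -> represents (fun x => map_mx f (v x)) M.
Proof. by move=> rv A sA; rewrite free_map_mx rv. Qed.

Lemma map_mx_fspan C w :
  w \in fspan v C -> map_mx f w \in fspan (fun x => map_mx f (v x)) C.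
Proof.
move=> /fspanP[t ->]; apply/fspanP; exists (f \o t); rewrite map_mx_sum.
by apply: eq_bigr => x _; rewrite map_mxZ.
Qed.

Lemma dot_map (h : 'rV[F]_n) (w : 'cV[F]_n) :
  (map_mx f h *m map_mx f w) 0 0 = f ((h *m w) 0 0).
Proof. by rewrite -map_mxM mxE. Qed.

End BaseChange.

(** * Merging the two sides of the minor *)

Section Merge.
Variables (F K : fieldType) (f : {rmorphism F -> K}) (T : finType) (n : nat).
Variables (v : T -> 'cV[F]_n) (h : T -> 'rV[F]_n) (X1 X2 : {set T}).
Variables (alpha beta : T -> K) (c d : T).
Hypothesis dual_h : {in X1 &, forall x y, (h x *m v y) 0 0 = (y == x)%:R}.
Hypothesis neq_cd : c != d.
Implicit Types (A C : {set T}) (w : 'cV[K]_n).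

Local Notation vf := (fun x => map_mx f (v x)).
Local Notation hf := (fun x => map_mx f (h x)).

(** By [dual_h], the projection with kernel [fspan v X1]; as a matrix over [F] it passes to [K]
    entrywise. *)
Definition quot_mx : 'M[F]_n := 1%:M - \sum_(x in X1) v x *m h x.

(* On a matrix with rows indexed by a basis containing [X1], this replaces the
   rows [x] in [X1] by the single row [c], their combination with coefficients
   [alpha x]; in [merged], the columns in [X2] are combined into the column [d]. *)
Definition merge_mx : 'M[K]_(n + 1, n) :=
  col_mx (map_mx f quot_mx) (\sum_(x in X1) alpha x *: hf x).

Definition merged (z : T) : 'cV[K]_(n + 1) :=
  if z == c then col_mx 0 1%:M
  else merge_mx *m (if z == d then \sum_(y in X2) beta y *: vf y else vf z).

Lemma quot_mxE w :
  map_mx f quot_mx *m w = w - \sum_(x in X1) (hf x *m w) 0 0 *: vf x.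
Proof.
rewrite map_mxB map_mx1 mulmxBl mul1mx map_mx_sum mulmx_suml; congr (_ - _).
apply: eq_bigr => x _; rewrite map_mxM -mulmxA [X in _ *m X = _]mx11_scalar.
by rewrite mul_mx_scalar.
Qed.

Lemma quot_mx_eq0 u : quot_mx *m u = 0 <-> u \in fspan v X1.
Proof.
have E : quot_mx *m u = u - \sum_(x in X1) (h x *m u) 0 0 *: v x.
  rewrite mulmxBl mul1mx mulmx_suml; congr (_ - _); apply: eq_bigr => x _.
  by rewrite -mulmxA [X in _ *m X = _]mx11_scalar mul_mx_scalar.
split=> [|/fspanP[t et]].
  by rewrite E => /eqP; rewrite subr_eq0 => /eqP e; apply/fspanP; eexists; apply: e.
rewrite E; apply/eqP; rewrite subr_eq0 et; apply/eqP; apply: eq_bigr => x xX.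
congr (_ *: _); rewrite mulmx_sumr summxE (bigD1 x) //= big1 => [|y /andP[yX nyx]].
  by rewrite addr0 -scalemxAr mxE dual_h // eqxx mulr1.
by rewrite -scalemxAr mxE dual_h // (negPf nyx) mulr0.
Qed.

Lemma merge_mxE w : merge_mx *m w =
  col_mx (map_mx f quot_mx *m w) (\sum_(x in X1) alpha x * (hf x *m w) 0 0)%:M.
Proof.
rewrite mul_col_mx; congr col_mx; rewrite mulmx_suml [LHS]mx11_scalar summxE.
by congr _%:M; apply: eq_bigr => x _; rewrite -scalemxAl mxE.
Qed.

(** The block [quot_mx] kills these columns, so all of them become multiples of the unit column
    [c]. *)
Lemma merge_mx_X1 x : x \in X1 -> merge_mx *m vf x = alpha x *: merged c.
Proof.
move=> xX; rewrite merge_mxE /merged eqxx scale_col_mx scaler0; congr col_mx.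
  by rewrite -map_mxM (quot_mx_eq0 _).2 ?map_mx0 // mem_fspan.
rewrite (bigD1 x) //= big1 => [|y /andP[yX nyx]].
  by rewrite dot_map dual_h // eqxx rmorph1 mulr1 addr0 scale_scalar_mx mulr1.
by rewrite dot_map dual_h // eq_sym (negPf nyx) rmorph0 mulr0.
Qed.

Lemma merge_mx_eq0 w : merge_mx *m w = 0 ->
  w = \sum_(x in X1) (hf x *m w) 0 0 *: vf x /\
  \sum_(x in X1) alpha x * (hf x *m w) 0 0 = 0.
Proof.
rewrite merge_mxE => /eqP; rewrite col_mx_eq0 quot_mxE subr_eq0.
move=> /andP[/eqP e /eqP/matrixP/(_ 0 0)]; rewrite !mxE eqxx mulr1n => e'.
by split.
Qed.

Lemma mergeE z : z \notin [set c; d] -> merged z = merge_mx *m vf z.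
Proof. by rewrite !inE negb_or /merged => /andP[/negPf-> /negPf->]. Qed.

Lemma merge_sum A (t : T -> K) : [disjoint A & [set c; d]] ->
  \sum_(x in A) t x *: merged x = merge_mx *m (\sum_(x in A) t x *: vf x).
Proof.
move=> dA; rewrite mulmx_sumr; apply: eq_bigr => x xA.
by rewrite mergeE ?(disjointFr dA) // scalemxAr.
Qed.

Lemma merge_fspan C u : [disjoint C & [set c; d]] -> u \in fspan v C ->
  merge_mx *m map_mx f u \in fspan merged C.
Proof.
move=> dC /(map_mx_fspan f)/fspanP[t ->]; rewrite -merge_sum //.
by apply/fspanP; exists t.
Qed.

(** Modulo the column [c] only the block [quot_mx] remains, whose kernel over [F] is the span of
    [X1]; base change preserves freeness. *)
Lemma merge_contract A : [disjoint A & [set c; d]] ->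
  indep_mod merged (fspan merged [set c]) A <-> indep_mod v (fspan v X1) A.
Proof.
move=> dA.
have memc w : (merge_mx *m w \in fspan merged [set c]) = (map_mx f quot_mx *m w == 0).
  apply/fspanP/eqP => [[t]|e].
    rewrite big_set1 merge_mxE /merged eqxx scale_col_mx scaler0.
    by move=> /eq_col_mx[].
  exists (fun=> \sum_(x in X1) alpha x * (hf x *m w) 0 0).
  rewrite big_set1 merge_mxE e /merged eqxx scale_col_mx scaler0.
  by rewrite scale_scalar_mx mulr1.
have freeE : indep_mod v (fspan v X1) A <->
          free [seq (quot_mx *m v x) | x in A].
  split=> [h0|/free_imageP h0 t /quot_mx_eq0].
    apply/free_imageP => t; rewrite memv0 => /eqP e; apply: h0.
    apply/quot_mx_eq0; rewrite mulmx_sumr -[RHS]e.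
    by apply: eq_bigr => x _; rewrite scalemxAr.
  rewrite mulmx_sumr => e; apply: h0; rewrite memv0 -[X in _ == X]e; apply/eqP.
  by apply: eq_bigr => x _; rewrite scalemxAr.
apply: iff_trans (iff_sym freeE); rewrite -(free_map_mx f).
have sumE (t : T -> K) : \sum_(x in A) t x *: map_mx f (quot_mx *m v x) =
    map_mx f quot_mx *m (\sum_(x in A) t x *: vf x).
  by rewrite mulmx_sumr; apply: eq_bigr => x _; rewrite map_mxM scalemxAr.
split=> [h0|/free_imageP h0 t].
  apply/free_imageP => t; rewrite sumE memv0 -memc -merge_sum //; exact: h0.
by rewrite merge_sum // memc => e; apply: h0; rewrite sumE memv0.
Qed.

(** The rows [h x] vanish on [C], so its merged columns have last coordinate 0 and cannot span [c];
    the column [d] combines columns that [C] spans. *)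
Lemma merge_iso_contraction C : [disjoint C & [set c; d]] ->
  {in X1, forall x, {in C, forall e, (h x *m v e) 0 0 = 0}} ->
  iso_contraction v X1 X2 C -> iso_contraction merged [set c] [set d] C.
Proof.
move=> dC hC [_ X2C]; split; last first.
  move=> y /set1P->; rewrite /merged eq_sym (negPf neq_cd) eqxx mulmx_sumr.
  apply: memv_suml => y' yX; rewrite -scalemxAr memvZ // merge_fspan //.
  exact: X2C.
apply/indep_mod1/negP => /fspanP[t]; rewrite merge_sum // merge_mxE /merged eqxx.
move=> /eq_col_mx[_ /matrixP/(_ 0 0)/eqP]; rewrite !mxE eqxx !mulr1n.
rewrite big1 ?oner_eq0 // => x xX; rewrite mulmx_sumr summxE big1 ?mulr0 // => e eC.
by rewrite -scalemxAr mxE dot_map hC // rmorph0 mulr0.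
Qed.

(** When [X1] or [X2] is empty the condition on products is vacuous, so those on [alpha] and [beta]
    are stated separately. *)
Hypothesis alpha_free : forall t : T -> F,
  \sum_(x in X1) alpha x * f (t x) = 0 -> {in X1, forall x, t x = 0}.
Hypothesis beta_free : forall t : T -> F,
  \sum_(y in X2) beta y * f (t y) = 0 -> {in X2, forall y, t y = 0}.
Hypothesis alpha_beta_free : forall t : T -> T -> F,
  \sum_(x in X1) \sum_(y in X2) alpha x * beta y * f (t x y) = 0 ->
  {in X1 & X2, forall x y, t x y = 0}.

(* A functional vanishing on [C] takes values in [F] on the [v y], so a relation
   over [K] between the merged vectors becomes a relation with coefficients in
   [F] between the products [alpha x * beta y]. *)
Lemma iso_contraction_merge C : [disjoint C & [set c; d]] ->
  iso_contraction merged [set c] [set d] C -> iso_contraction v X1 X2 C.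
Proof.
move=> dC [/indep_mod1 cC /(_ d (set11 d)) dinC].
(* A relation on [X1] modulo [C] puts a multiple of [c] in the span of [C]; its coefficient, the sum
   of the [alpha x * f (t x)], must vanish. *)
have indX1 : indep_mod v (fspan v C) X1.
  move=> t /(merge_fspan dC); rewrite map_mx_sum mulmx_sumr => tC.
  apply: alpha_free; apply: contraNeq cC => nz.
  rewrite -[merged c](scalerK nz) memvZ // scaler_suml.
  rewrite (eq_bigr (fun x => merge_mx *m map_mx f (t x *: v x))) // => x xX.
  by rewrite map_mxZ -scalemxAr merge_mx_X1 // scalerA mulrC.
split=> // y0 y0X.
(* These rows are dual to [X1] and zero on the present [C], which is not assumed of [h]. *)
have [g gP] := dual_rows indX1.
have /fspanP[s] := dinC; rewrite merge_sum // /merged eq_sym (negPf neq_cd) eqxx.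
move=> /eqP; rewrite -subr_eq0 -mulmxBr => /eqP/merge_mx_eq0.
(* Here [w] is the combination defining [d] minus its expression through [C], both taken before
   merging; it lies in the kernel of [merge_mx]. *)
set w := _ - _; set G := fun x => (hf x *m w) 0 0.
rewrite -/(G _) => -[ew eG].
have dotw (r : 'rV[F]_n) : {in fspan v C, forall u, (r *m u) 0 0 = 0} ->
    (map_mx f r *m w) 0 0 = \sum_(y in X2) beta y * f ((r *m v y) 0 0).
  move=> rC; rewrite mulmxBr !mulmx_sumr mxE [X in _ + X]mxE !summxE [X in _ - X]big1 ?subr0.
    by apply: eq_bigr => y _; rewrite -scalemxAr mxE dot_map.
  by move=> e eC; rewrite -scalemxAr mxE dot_map rC ?rmorph0 ?mulr0 // mem_fspan.
(* Applying [g x] to [w] reads off [G x] as a combination of the [beta y] with coefficients in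
   [F]. *)
have GE x : x \in X1 -> G x = \sum_(y in X2) beta y * f ((g x *m v y) 0 0).
  move=> xX; have [gC gX] := gP x xX; rewrite -dotw // [in RHS]ew.
  rewrite mulmx_sumr summxE (bigD1 x) //= big1 => [|y /andP[yX nyx]].
    by rewrite -scalemxAr mxE dot_map gX // eqxx rmorph1 mulr1 addr0.
  by rewrite -scalemxAr mxE dot_map gX // (negPf nyx) rmorph0 mulr0.
(* Substituted in [eG], this is a relation among the products [alpha x * beta y], so the pivoted
   [X1]-[X2] block is zero. *)
have g0 : {in X1 & X2, forall x y, (g x *m v y) 0 0 = 0}.
  apply: alpha_beta_free; rewrite -[RHS]eG; apply: eq_bigr => x xX.
  by rewrite -/(G x) GE // mulr_sumr; apply: eq_bigr => y _; rewrite mulrA.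
have w0 : w = 0.
  rewrite ew big1 // => x xX; rewrite -/(G x) GE // big1 ?scale0r // => y yX.
  by rewrite g0 // rmorph0 mulr0.
(* A functional zero on [C] but not at [v y0] would give a nontrivial relation among the [beta y],
   as its value on [w] is 0. *)
apply/negPn/negP => /separating_row[r rC /eqP[]].
apply: (beta_free (t := fun y => (r *m v y) 0 0)) y0X.
by rewrite -dotw // w0 mulmx0 mxE.
Qed.

End Merge.

(** * Powers of one element as merging coefficients, and the merged matroid *)

Lemma powers_free (F K : fieldType) (f : {rmorphism F -> K}) (g : K) (N : nat)
    (I : finType) (A : {set I}) (e : I -> nat) (t : I -> F) :
  (forall P : {poly F}, (size P <= N)%N -> root (map_poly f P) g -> P = 0) ->
  {in A, forall i, e i < N}%N -> {in A &, injective e} ->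
  \sum_(i in A) g ^+ e i * f (t i) = 0 -> {in A, forall i, t i = 0}.
Proof.
(* The relation says that [g] is a root of [P]; injectivity of [e] lets [t i] be read off as a
   coefficient. *)
move=> gP eN inj_e t0 i iA; pose P := \sum_(j in A) t j *: 'X^(e j).
have P0 : P = 0.
  apply: gP.
    apply: (big_ind (fun Q : {poly F} => size Q <= N)%N) => [|p q sp sq|j jA].
    - by rewrite size_poly0.
    - by apply: leq_trans (size_polyD _ _) _; rewrite geq_max sp sq.
    by apply: leq_trans (size_scale_leq _ _) _; rewrite size_polyXn eN.
  rewrite /root -[X in _ == X]t0 rmorph_sum horner_sum; apply/eqP.
  apply: eq_bigr => j _.
  by rewrite /= linearZ /= map_polyXn hornerZ hornerXn mulrC.
have := congr1 (fun Q : {poly F} => Q`_(e i)) P0.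
rewrite coef0 coef_sum (bigD1 i) //= big1 => [|j /andP[jA nji]].
  by rewrite coefZ coefXn eqxx mulr1 addr0.
rewrite coefZ coefXn; have [/inj_e eij|] := eqVneq (e i) (e j); last by rewrite mulr0.
by rewrite eij ?eqxx // in nji.
Qed.

Lemma merge_matroid (F K : fieldType) (f : {rmorphism F -> K}) (T : finType)
    (g : K) (N : nat) (X1 X2 : {set T}) (M : matroid T) (c d : T) :
  [disjoint X1 & X2] -> (#|X1 :|: X2| ^ 2 <= N)%N ->
  (forall P : {poly F}, (size P <= N)%N -> root (map_poly f P) g -> P = 0) ->
  representable F M -> fragile (iso X1 (X1 :|: X2)) M ->
  c != d -> c \notin ground M -> d \notin ground M ->
  exists M' : matroid T,
    [/\ fragile (iso [set c] [set c; d]) M', representable K M',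
        ground M' = (ground M :\: (X1 :|: X2)) :|: [set c; d] &
        delete (contract M' [set c]) [set d] = delete (contract M X1) X2].
Proof.
move=> dX leN gP [n [v rv]] /(fragile_isoP rv dX)[sX [C0 sC0 gC0] uniqC] ncd cM dM.
set X := X1 :|: X2 in leN sX sC0 uniqC *; set k := #|X| in leN.
pose i x := index x (enum X).
have ik x : x \in X -> (i x < k)%N by rewrite /i /k cardE index_mem mem_enum.
have inj_i : {in X &, injective i}.
  move=> x y xX yX e; rewrite -[x](nth_index x (s := enum X)) ?mem_enum //.
  by rewrite -/(i x) e nth_index ?mem_enum.
have [sX1 sX2] : X1 \subset X /\ X2 \subset X by rewrite subsetUl subsetUr.
have k0 x : x \in X -> (0 < k)%N by move=> xX; apply/card_gt0P; exists x.
(* The exponents are two-digit numbers in base [k]: they stay below [k ^ 2] and, by [injk],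
   determine their digits. *)
have lekk a b : (a < k -> b < k -> a + k * b < N)%N.
  move=> ak bk; apply: leq_trans leN; rewrite expnS expn1.
  by apply: leq_trans (leq_mul (leqnn k) bk); rewrite mulnS ltn_add2r.
have injk a b a' b' : (a < k -> a' < k -> a + k * b = a' + k * b' -> a = a' /\ b = b')%N.
  move=> ak ak' e; have kp : (0 < k)%N by apply: leq_ltn_trans ak.
  move: e; rewrite addnC mulnC [RHS]addnC [X in _ = (X + _)%N]mulnC => e.
  have := congr1 (modn^~ k) e; have := congr1 (divn^~ k) e.
  by rewrite /= !modnMDl !divnMDl // !divn_small // !modn_small // !addn0.
pose alpha x := g ^+ i x; pose beta y := g ^+ (k * i y).
have alphaP (t : T -> F) :
    \sum_(x in X1) alpha x * f (t x) = 0 -> {in X1, forall x, t x = 0}.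
  apply: powers_free gP _ _ => [x|x y] /(subsetP sX1) xX; last first.
    by move=> /(subsetP sX1); apply: inj_i.
  by have := lekk (i x) 0%N (ik x xX) (k0 x xX); rewrite muln0 addn0.
have betaP (t : T -> F) :
    \sum_(y in X2) beta y * f (t y) = 0 -> {in X2, forall y, t y = 0}.
  apply: powers_free gP _ _ => [x|x y] /(subsetP sX2) xX.
    exact: lekk (k0 x xX) (ik x xX).
  move=> /(subsetP sX2) yX /eqP; rewrite eqn_pmul2l ?(k0 x) // => /eqP.
  exact: inj_i.
have abP (t : T -> T -> F) :
    \sum_(x in X1) \sum_(y in X2) alpha x * beta y * f (t x y) = 0 ->
    {in X1 & X2, forall x y, t x y = 0}.
  rewrite pair_big /= => t0 x y xX yX.
  apply: (@powers_free F K f g N _ (setX X1 X2) (fun p => i p.1 + k * i p.2)%N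
    (fun p => t p.1 p.2) gP _ _ _ (x, y)).
  - move=> [x' y'] /setXP[/(subsetP sX1) xX' /(subsetP sX2) yX'].
    by apply: lekk; apply: ik.
  - move=> [x1 y1] [x2 y2] /setXP[/(subsetP sX1) xX1 /(subsetP sX2) yX1].
    move=> /setXP[/(subsetP sX1) xX2 /(subsetP sX2) yX2] /= e.
    by have [/inj_i-> // /inj_i-> //] := injk _ _ _ _ (ik _ xX1) (ik _ xX2) e.
  - rewrite -[RHS]t0; apply: eq_big => [p|p _]; first by rewrite inE.
    by rewrite exprD.
  by apply/setXP.
(* Choosing the dual rows modulo [fspan v C0] makes them vanish on [C0], so the same [C0] yields the
   minor after merging. *)
have [h hP] := dual_rows gC0.1.
have dual_h : {in X1 &, forall x y, (h x *m v y) 0 0 = (y == x)%:R}.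
  by move=> x y xX yX; apply: (hP x xX).2.
have dCd (C : {set T}) : C \subset ground M :\: X -> [disjoint C & [set c; d]].
  move=> sC; rewrite disjoint_sym disjoints_subset subUset !sub1set !inE.
  apply/andP; split; apply/negP => /(subsetP sC)/setDP[eM _].
    by rewrite eM in cM.
  by rewrite eM in dM.
pose v' := merged f v h X1 X2 alpha beta c d.
pose E' := ground M :\: X :|: [set c; d]; pose M' := vector_matroid v' E'.
have rv' : represents v' M' by apply: vector_matroid_represents.
have dcd : [disjoint [set c] & [set d]] by rewrite disjoints1 inE.
have eE' : E' :\: [set c; d] = ground M :\: X.
  rewrite setDUl setDv setU0; apply/setDidPl; exact: dCd.
exists M'; split=> //; last 1 first.
- apply: matroid_eq => /=.
    by rewrite setDDl eE' setDDl.
  have sc : [set c] \subset E' by rewrite sub1set !inE eqxx orbT.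
  apply/setP => A; rewrite [LHS]inE [RHS]inE.
  have sX1M := subset_trans sX1 sX.
  apply/andP/andP => -[].
    move=> /(contract_indepP _ rv' sc)[/= sA iA] dA.
    have {}sA : A \subset ground M :\: X.
      by rewrite -eE' -setDDl subsetD sA.
    have dA' := dCd _ sA; move: sA; rewrite -setDDl subsetD => /andP[sA dA2].
    split=> //; apply/(contract_indepP _ rv sX1M); split=> //.
    exact/(merge_contract f X2 alpha beta dual_h dA').
  move=> /(contract_indepP _ rv sX1M)[/= sA iA] dA.
  have {}sA : A \subset ground M :\: X by rewrite -setDDl subsetD sA.
  have dA' := dCd _ sA; move: (sA); rewrite -eE' -setDDl subsetD => /andP[sA' dA2].
  split=> //; apply/(contract_indepP _ rv' sc); split=> //.
  exact/(merge_contract f X2 alpha beta dual_h dA').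
- apply/(fragile_isoP rv' dcd); rewrite /= eE'; split.
  + exact: subsetUr.
  + exists C0 => //; apply: merge_iso_contraction => //; first exact: dCd.
    by move=> x xX e eC; apply: (hP x xX).1; apply: mem_fspan.
  move=> C C' sC sC' gC gC'; apply: uniqC => //.
    by apply: (iso_contraction_merge dual_h ncd alphaP betaP abP _ gC); apply: dCd.
  by apply: (iso_contraction_merge dual_h ncd alphaP betaP abP _ gC'); apply: dCd.
by exists (n + 1)%N, v'.
Qed.

(* Representation over every field of order [q ^ (k ^ 2)] *)
Close Scope ring_scope.

Theorem theorem1p5 (F : finFieldType) (q k : nat) (T : finType)
    (X1 X2 : {set T}) (M : matroid T) (c d : T) :
  #|F| = q ->
  [disjoint X1 & X2] ->
  #|X1 :|: X2| = k ->
  representable F M ->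
  fragile (iso X1 (X1 :|: X2)) M ->
  c != d -> c \notin ground M -> d \notin ground M ->
  exists M' : matroid T,
    [/\ fragile (iso [set c] [set c; d]) M',
        forall K : finFieldType, #|K| = q ^ (k ^ 2) -> representable K M',
        ground M' = (ground M :\: (X1 :|: X2)) :|: [set c; d] &
        delete (contract M' [set c]) [set d] = delete (contract M X1) X2].
Proof.
move=> <- dX <-; set k2 := (_ ^ 2)%N => rM frM ncd cM dM.
(* For [k = 0] no field has order [q ^ 0], but [M'] must still exist; the exponent [maxn 1 k2]
   supplies a field to build it over. *)
have [L cL [f _]] := finField_extension F (leq_maxl 1 k2).
have [g gP] := finField_power_independent f cL.
have [M' [frM' [n [v rv]] gM' eM']] :=
  merge_matroid dX (leq_maxr 1 k2) gP rM frM ncd cM dM.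
exists M'; split=> // K cK.
(* The existence of [K] forces [k2] to be positive, so [K] and [L] have equal order and [L] embeds
   in [K]. *)
have k20 : (0 < k2)%N.
  by rewrite lt0n; apply: contraTneq (finNzRing_gt1 K) => k0; rewrite cK k0.
have [|f' _] := @finField_embedding L K 1.
  by rewrite expn1 cK cL (maxn_idPr k20).
by exists n, (fun x => map_mx f' (v x)); apply: represents_map.
Qed.
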